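(* Let $X$ be a $k$-regular graph on $n$ vertices, and let $a$ be a marked vertex of $X$. Let $R$, $C$, $O_a$ be the arc-reversal matrix, the coin matrix and the oracle, let $K$, $N$ be the matrices defined in the context, and let $$\widetilde{A}=\begin{pmatrix} 0 & [\,K^*\;\;0\,]\\ \begin{bmatrix}K\\0\end{bmatrix} & A(X\backslash a)\end{pmatrix},$$ a Hermitian matrix of order $(k-1)+(n-1)$. Then the eigenspaces of the transition matrix $U=RCO_a$ satisfy the following. (i) There is a one-to-one correspondence between the conjugate pairs of non-real eigenvalues $e^{\pm i\theta}$ of $U$ and the eigenvalues $\lambda$ of $\widetilde{A}$ that lie strictly between $-k$ and $k$, and they are related by $\lambda=k\cos(\theta)$. Moreover, if $F_\theta$ is the orthogonal projection onto the $e^{i\theta}$-eigenspace of $U$, and $\widetilde{E}_\lambda$ is the orthogonal projection onto the $\lambda$-eigenspace of $\widetilde{A}$, then $$F_\theta=\frac{1}{2k\sin^2(\theta)}\,(N-e^{i\theta}RN)\,\widetilde{E}_\lambda\,(N-e^{i\theta}RN)^*.$$ (ii) If $X$ is $2$-connected, then the $1$-eigenspace of $U$ is orthogonal to $\mathrm{span}\{\mathbf{1}_{nk}\}$, where $\mathbf{1}_{nk}$ is the all-ones vector.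
   Context: Graphs are finite and simple. Each edge $\{u,v\}$ of $X$ is viewed as a pair of arcs $(u,v)$, $(v,u)$, and vectors in $\mathbb{C}^n\otimes\mathbb{C}^k\cong\mathbb{C}^{nk}$ are complex-valued functions on the $nk$ arcs, grouped by tail (the first factor indexes the tail $u$, the second the outgoing arcs of $u$). The matrices acting on this space are: - $R$: the permutation matrix swapping $(u,v)$ with $(v,u)$ for every arc. - $C=I_n\otimes(\frac{2}{k}J_k-I_k)$, i.e. $(Cf)(u,v)=\frac{2}{k}\sum_{w\sim u}f(u,w)-f(u,v)$, where $J$ is the all-ones matrix. - $O_a=(I_n-2E_{aa})\otimes I_k$, i.e. $(O_af)(u,v)=-f(u,v)$ if $u=a$, and $f(u,v)$ otherwise. Order the neighbors of $a$ as $v_1,\dots,v_k$. $K$ is the $k\times(k-1)$ matrix with entries $K_{j\ell}=e^{2\pi i(j-1)\ell/k}$, $1\le j\le k$, $1\le \ell\le k-1$. $N$ is the $nk\times\big((k-1)+(n-1)\big)$ block diagonal matrix with $n$ diagonal blocks: the block for tail $a$ is $K$ (its $j$-th row indexed by the arc $(a,v_j)$), and the block for each unmarked vertex $u\neq a$ is the single column $\mathbf{1}_k$ (rows indexed by the outgoing arcs of $u$). $X\backslash a$ is the graph obtained from $X$ by deleting $a$ and $A(X\backslash a)$ is its adjacency matrix. In $\widetilde{A}$, the block $\begin{bmatrix}K\\0\end{bmatrix}$ has rows indexed by the vertices of $X\backslash a$: the row of $v_j$ is the $j$-th row of $K$, and the rows of vertices not adjacent to $a$ are zero. *)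

(* Defs.v *)
From HB Require Import structures.
From mathcomp Require Import all_boot all_order all_algebra.
From mathcomp Require Import sesquilinear spectral.
From mathcomp Require Import classical_sets functions reals trigo.
From mathcomp Require Import complex.

Set Implicit Arguments.
Unset Strict Implicit.
Unset Printing Implicit Defensive.

Import Order.TTheory GRing.Theory Num.Theory.
Local Open Scope ring_scope.
Local Open Scope sesquilinear_scope.
Local Open Scope complex_scope.

Section Graphs.
Variables (n : nat) (e : rel 'I_n).

Definition simple_graph := symmetric e /\ irreflexive e.

Definition regular (k : nat) := forall u : 'I_n, #|[set w | e u w]%SET| = k.

Definition connected_outside (S : {set 'I_n}) :=
  forall x y, x \notin S -> y \notin S ->
    connect (fun u w => [&& e u w, u \notin S & w \notin S]) x y.

Definition two_connected :=
  (2 < n)%N /\ forall S : {set 'I_n}, (#|S| < 2)%N -> connected_outside S.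

Definition arc := {p : 'I_n * 'I_n | e p.1 p.2}.
Definition arcs := #|{: arc}|.

Definition tail (p : 'I_arcs) : 'I_n := (val (enum_val p)).1.
Definition head (p : 'I_arcs) : 'I_n := (val (enum_val p)).2.

End Graphs.

Section ComplexMatrices.
Variable R : realType.

Definition cis (x : R) : R[i] := cos x +i* sin x.

(* The library's eigenspaces and orthogonal projections act on row vectors;
   the two transpositions give the action on column vectors (see eigenprojP). *)
Definition eigenproj m (M : 'M[R[i]]_m) (z : R[i]) : 'M[R[i]]_m :=
  (proj_ortho (eigenspace M^T z))^T.

Definition nonreal_eigenvalue m (M : 'M[R[i]]_m) (z : R[i]) : Prop :=
  eigenvalue M z /\ z \isn't Num.real.

Definition conjugate_pairs m (M : 'M[R[i]]_m) : set (set R[i]) :=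
  [set P | exists2 z, nonreal_eigenvalue M z & P = [set z; z^*]%classic]%classic.

Lemma eigenprojP m (M : 'M[R[i]]_m) (z : R[i]) :
  let P := eigenproj M z in
  [/\ P *m P = P, P ^t* = P & forall v : 'cV_m, P *m v = v <-> M *m v = z *: v].
Proof.
rewrite /eigenproj; set U := eigenspace _ _; set Q := proj_ortho U.
have QQ : Q *m Q = Q by exact: proj_ortho_proj.
have o0 : Q *m (1%:M - Q) ^t* = 0.
  apply/orthomx1P; rewrite orthomx_sym (eqmx_ortho _ (proj_orthoE U)).
  by have := proj_ortho_compl_sub U (1%:M : 'M_m); rewrite mul1mx.
have QE : Q = Q *m Q ^t*.
  have dE : (1%:M - Q) ^t* = 1%:M - Q ^t*.
    by apply/matrixP => i j; rewrite !mxE rmorphB rmorph_nat eq_sym.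
  by apply/eqP; rewrite -subr_eq0 -{1}[Q]mulmx1 -mulmxBr -dE o0.
have Qsa : Q ^t* = Q by rewrite QE trmx_mul map_mxM trmxCK -QE.
split; first by rewrite -trmx_mul QQ.
  by rewrite trmxK -[in RHS]Qsa -map_trmx trmxK.
have tr_eq p q (A B : 'M[R[i]]_(p, q)) : A^T = B^T <-> A = B.
  by split=> [/trmx_inj|->].
move=> v; rewrite -tr_eq trmx_mul trmxK -[M *m v = _]tr_eq trmx_mul linearZ /=.
split=> [<-|/eigenspaceP]; last exact: proj_ortho_id.
by apply/eigenspaceP; rewrite proj_ortho_sub.
Qed.

End ComplexMatrices.

Section QuantumWalk.
Variables (R : realType) (n k : nat) (e : rel 'I_n) (a : 'I_n).

Definition arc_reversal : 'M[R[i]]_(arcs e) :=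
  \matrix_(p, q) ((tail p == head q) && (head p == tail q))%:R.

Definition coin : 'M[R[i]]_(arcs e) :=
  \matrix_(p, q) (2 / k%:R * (tail p == tail q)%:R - (p == q)%:R).

Definition oracle : 'M[R[i]]_(arcs e) :=
  diag_mx (\row_p (if tail p == a then -1 else 1)).

Definition transition : 'M[R[i]]_(arcs e) := arc_reversal *m coin *m oracle.

(* The column index l : 'I_k.-1 stands for the exponent l + 1 in 1, ..., k-1. *)
Definition Kmx : 'M[R[i]]_(k, k.-1) :=
  \matrix_(j, l) cis (2 * pi * (j * l.+1)%:R / k%:R).

Variable v : 'I_k -> 'I_n.

Definition enumerates_neighbors :=
  injective v /\ forall w, e a w <-> exists j, v j = w.

(* The entry in column l of the row of K that belongs to the neighbor u of a,
   and 0 if u is not a neighbor of a. *)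
Definition Krow (u : 'I_n) (l : 'I_k.-1) : R[i] := \sum_(j | v j == u) Kmx j l.

(* The vertices other than a are indexed by 'I_n.-1 through [lift a]. *)
Definition Nmx : 'M[R[i]]_(arcs e, k.-1 + n.-1) :=
  row_mx (\matrix_(p, l) (if tail p == a then Krow (head p) l else 0))
         (\matrix_(p, u) (tail p == lift a u)%:R).

Definition deleted_adjacency : 'M[R[i]]_n.-1 :=
  \matrix_(u, w) (e (lift a u) (lift a w))%:R.

Definition K0mx : 'M[R[i]]_(n.-1, k.-1) := \matrix_(u, l) Krow (lift a u) l.

Definition Atilde : 'M[R[i]]_(k.-1 + n.-1) :=
  block_mx 0 (K0mx ^t*) K0mx deleted_adjacency.

End QuantumWalk.

(* Main.v *)
Require Import Defs.
From HB Require Import structures.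
From mathcomp Require Import all_boot all_order all_algebra.
From mathcomp Require Import sesquilinear spectral.
From mathcomp Require Import classical_sets functions reals trigo.
From mathcomp Require Import complex.
From mathcomp Require Import ring lra.

Set Implicit Arguments.
Unset Strict Implicit.
Unset Printing Implicit Defensive.

Import Order.TTheory GRing.Theory Num.Theory.
Local Open Scope ring_scope.
Local Open Scope sesquilinear_scope.

(** The walk is a product of two reflections. On the arcs leaving an unmarked
vertex the coin is twice the projection onto the constants, minus the
identity; on the arcs leaving [a] the oracle flips its sign, so there C O_a is
twice the projection onto the orthogonal complement of the constants, minus
the identity. The columns of N span exactly the sum of these ranges: 1_k for
each unmarked vertex, and the nontrivial characters of Z/k for [a]. They are
orthogonal of squared norm k ([Nmx_gram]), hence U = R (2/k N N* - I)
([transitionE]), and counting arcs gives N* R N = A~ ([Nmx_compression]).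

For such a product everything in (i) is linear algebra. Put L = N - z R N with
|z| = 1. If A~ y = l y with 2 l = k (z + 1/z), then U L y = z L y
([lift_mx_eigen]), and L* L = 2k - (z + 1/z) A~ ([lift_mx_gram]) shows that
L y <> 0 unless z = 1 or z = -1. In the other direction, U x = z x forces N* x
to be an eigenvector of A~ for that same l ([compression_eigen]), and
L (N* x) = k/2 (1 - z^2) x ([lift_mx_project]) recovers x from it. So y |-> L y
and x |-> N* x are inverse to each other up to a scalar, and that scalar is the
coefficient in the formula for F_theta ([walk_projection]). With z = e^{i theta}
the relation between l and z reads l = k cos theta.

For (ii), a fixed vector x of U satisfies N N* x = k/2 (R x + x), so
w = N N* x is invariant under reversing arcs. Like every vector in the range of
N, w depends only on the tail away from [a] and sums to 0 over the arcs leaving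
[a]. Since X \ a is connected, w is constant, and the vanishing sum makes it 0.
Then R x = - x, and the entries of x cancel in pairs. *)

(** * Products of two reflections *)

Section Adjoint.
Variable C : numClosedFieldType.

Lemma adjM m n p (A : 'M[C]_(m, n)) (B : 'M[C]_(n, p)) :
  (A *m B) ^t* = B ^t* *m A ^t*.
Proof. by rewrite trmx_mul map_mxM. Qed.

Lemma adjB m n (A B : 'M[C]_(m, n)) : (A - B) ^t* = A ^t* - B ^t*.
Proof. by rewrite linearB /= map_mxB. Qed.

Lemma adjZ m n z (A : 'M[C]_(m, n)) : (z *: A) ^t* = z^* *: A ^t*.
Proof. by rewrite linearZ /= map_mxZ. Qed.

Lemma adj1 n : (1%:M : 'M[C]_n) ^t* = 1%:M.
Proof. by rewrite tr_scalar_mx map_scalar_mx rmorph1. Qed.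

Lemma adj_mul_eq0 m (x : 'cV[C]_m) : x ^t* *m x = 0 -> x = 0.
Proof.
move=> /matrixP/(_ 0 0); rewrite !mxE => sum0.
have /psumr_eq0P norm0 : \sum_i `|x i 0| ^+ 2 = 0.
  by rewrite -[RHS]sum0; apply: eq_bigr => i _; rewrite !mxE normCKC.
apply/matrixP => i j; rewrite ord1 mxE; apply/eqP.
by rewrite -normr_eq0 -sqrf_eq0 norm0 // => l _; rewrite exprn_ge0.
Qed.

(** Eigenvectors are rows in the definition of [eigenvalue]; a matrix and its
transpose have the same characteristic polynomial, so columns serve as well. *)
Lemma eigenvalue_colP m (M : 'M[C]_m) z :
  reflect (exists2 x : 'cV_m, M *m x = z *: x & x != 0) (eigenvalue M z).
Proof.
have -> : eigenvalue M z = eigenvalue M^T z.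
  rewrite !eigenvalue_root_char /char_poly -[in RHS]det_tr /char_poly_mx.
  by rewrite linearB /= tr_scalar_mx map_trmx trmxK.
apply: (iffP eigenvalueP) => [] [x xM x0]; exists x^T; rewrite ?trmx_eq0 //.
  by apply: trmx_inj; rewrite trmx_mul linearZ /= trmxK.
by rewrite -trmx_mul xM linearZ.
Qed.

End Adjoint.

Section ProductOfReflections.
Variables (C : numClosedFieldType) (m d k : nat).
Variables (Rv U : 'M[C]_m) (N : 'M[C]_(m, d)) (A : 'M[C]_d).
Hypothesis k_gt0 : (0 < k)%N.
Hypothesis RvRv : Rv *m Rv = 1%:M.
Hypothesis Rv_adj : Rv ^t* = Rv.
Hypothesis NN : N ^t* *m N = k%:R *: 1%:M.
Hypothesis UE : U = Rv *m ((2 / k%:R) *: (N *m N ^t*) - 1%:M).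
Hypothesis AE : A = N ^t* *m Rv *m N.

Let k_neq0 : k%:R != 0 :> C.
Proof. by rewrite pnatr_eq0 -lt0n. Qed.

Definition lift_mx z := N - z *: (Rv *m N).

Lemma compression_hermitian : A ^t* = A.
Proof. by rewrite AE !adjM trmxCK Rv_adj mulmxA. Qed.

Lemma walk_unitary : U ^t* *m U = 1%:M.
Proof.
rewrite UE !adjM Rv_adj -mulmxA (mulmxA Rv) RvRv mul1mx.
rewrite adjB adjZ adj1 adjM trmxCK rmorphM fmorphV /= !conjC_nat.
rewrite mulmxBr mulmx1 mulmxBl mul1mx opprB -scalemxAr -scalemxAl.
rewrite mulmxA -(mulmxA N) NN -scalemxAr mulmx1 -scalemxAl !scalerA.
have -> : 2 / k%:R * (2 / k%:R) * k%:R = 2 / k%:R + 2 / k%:R :> C by field.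
by rewrite scalerDl addrK addrC subrK.
Qed.

Lemma walk_eigenvalue_norm z : eigenvalue U z -> z^* * z = 1.
Proof.
case/eigenvalue_colP => x Ux x0.
have /eqP : x ^t* *m x = (z^* * z) *: (x ^t* *m x).
  rewrite -scalerA [z *: _]scalemxAr scalemxAl -adjZ -Ux adjM.
  by rewrite -mulmxA (mulmxA (U ^t*)) walk_unitary mul1mx.
rewrite -subr_eq0 -{1}[x ^t* *m x]scale1r -scalerBl scaler_eq0 subr_eq0.
case/orP => /eqP; first by move->.
by move/adj_mul_eq0/eqP; rewrite (negPf x0).
Qed.

Lemma walk_range : U *m N = Rv *m N.
Proof.
rewrite UE -mulmxA mulmxBl mul1mx -scalemxAl -mulmxA NN -scalemxAr scalerA.
by rewrite divfK // mulmx1 scaler_nat mulr2n addrK.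
Qed.

Lemma walk_reversed_range :
  U *m (Rv *m N) = (2 / k%:R) *: (Rv *m N *m A) - N.
Proof.
rewrite UE AE -!mulmxA mulmxBl mul1mx mulmxBr (mulmxA Rv Rv) RvRv mul1mx.
by rewrite -scalemxAl -scalemxAr -!mulmxA.
Qed.

(** For an eigenvector y of A the span of N y and R N y is stable under U, which
acts on it with eigenvalues z and 1/z. *)
Lemma lift_mx_eigen z l p (Y : 'M_(d, p)) :
  l = k%:R / 2 * (z + z^-1) -> z != 0 -> A *m Y = l *: Y ->
  U *m (lift_mx z *m Y) = z *: (lift_mx z *m Y).
Proof.
move=> lE z0 AY; rewrite mulmxA mulmxBr -scalemxAr walk_range.
rewrite walk_reversed_range !mulmxBl -!scalemxAl mulmxBl -scalemxAl.
rewrite -[Rv *m N *m A *m Y]mulmxA AY -scalemxAr !scalerBr !scalerA opprB.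
have -> : z * (2 / k%:R) * l = z * z + 1 by rewrite lE; field; rewrite z0.
by move: (Rv *m N *m Y) => V; apply/matrixP => i j; rewrite !mxE; ring.
Qed.

(** The squared length of a lift: on an [l]-eigenvector of A it multiplies the
squared norm by 2k - (z + conj z) l; for l = k/2 (z + 1/z) this vanishes only
when z = 1 or z = -1. *)
Lemma lift_mx_gram z :
  z^* * z = 1 ->
  lift_mx z ^t* *m lift_mx z = (k%:R *+ 2) *: 1%:M - (z + z^*) *: A.
Proof.
move=> zz; rewrite adjB adjZ adjM Rv_adj mulmxBl !mulmxBr NN.
rewrite -!scalemxAl -!scalemxAr !mulmxA -(mulmxA _ Rv Rv) RvRv mulmx1 NN -AE.
rewrite scalerA zz scale1r; move: (A) (1%:M : 'M_d) => B I.
by apply/matrixP => i j; rewrite !mxE; ring.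
Qed.

Section Eigenvector.
Variables (z : C) (p : nat) (X : 'M[C]_(m, p)).
Hypotheses (z_neq0 : z != 0) (UX : U *m X = z *: X).

(** R is an involution, so U X = z X says that (2/k N N* - I) X = z R X. *)
Lemma walk_eigen_project : N *m (N ^t* *m X) = (k%:R / 2) *: (z *: (Rv *m X) + X).
Proof.
have : Rv *m (U *m X) = z *: (Rv *m X) by rewrite UX -scalemxAr.
rewrite UE !mulmxA RvRv mul1mx mulmxBl mul1mx -scalemxAl => /eqP.
rewrite subr_eq -mulmxA => /eqP <-; rewrite scalerA.
by rewrite mulrA divfK ?pnatr_eq0 // divff // scale1r.
Qed.

Lemma walk_eigen_reverse : N ^t* *m (Rv *m X) = z^-1 *: (N ^t* *m X).
Proof.
have := congr1 (mulmx (N ^t*)) walk_eigen_project.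
rewrite mulmxA NN -scalemxAl mul1mx -scalemxAr mulmxDr -scalemxAr.
move: (N ^t* *m X) (N ^t* *m (Rv *m X)) => Y W /matrixP eYW.
apply/matrixP => i j; have := eYW i j; rewrite !mxE => e_ij.
apply: (mulfI z_neq0); rewrite mulVKf //; apply: (mulfI k_neq0).
have -> : k%:R * (z * W i j) = k%:R / 2 * (z * W i j + Y i j) *+ 2 - k%:R * Y i j.
  by field.
by rewrite -e_ij; ring.
Qed.

Lemma compression_eigen :
  A *m (N ^t* *m X) = (k%:R / 2 * (z + z^-1)) *: (N ^t* *m X).
Proof.
rewrite AE -!mulmxA walk_eigen_project -!scalemxAr !mulmxDr -!scalemxAr.
by rewrite (mulmxA Rv) RvRv mul1mx walk_eigen_reverse -scalerDl scalerA.
Qed.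

Lemma lift_mx_project :
  lift_mx z *m (N ^t* *m X) = (k%:R / 2 * (1 - z ^+ 2)) *: X.
Proof.
rewrite mulmxBl -scalemxAl -mulmxA walk_eigen_project -scalemxAr mulmxDr.
rewrite -scalemxAr (mulmxA Rv) RvRv mul1mx.
by move: (Rv *m X) => V; apply/matrixP => i j; rewrite !mxE; ring.
Qed.

Lemma lift_mx_adj_project :
  z^* = z^-1 -> lift_mx z ^t* *m X = (1 - z^-1 ^+ 2) *: (N ^t* *m X).
Proof.
move=> zz; rewrite adjB adjZ adjM Rv_adj mulmxBl -scalemxAl -mulmxA.
by rewrite walk_eigen_reverse zz scalerA scalerBl scale1r expr2.
Qed.

End Eigenvector.

(** [E] and [Q] are any Hermitian matrices fixing the two eigenspaces and with
columns inside them. The right-hand side F satisfies Q F = F because its columns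
are lifts of eigenvectors of A, and F Q = Q because lifting undoes projecting up
to a scalar. Both F and Q are Hermitian, so the second identity also reads
Q F = Q. *)
Lemma walk_projection (z l : C) (E : 'M[C]_d) (Q : 'M[C]_m) :
    z^* * z = 1 -> z ^+ 2 != 1 -> l = k%:R / 2 * (z + z^-1) ->
    E ^t* = E -> A *m E = l *: E ->
    (forall p (Y : 'M_(d, p)), A *m Y = l *: Y -> E *m Y = Y) ->
    Q ^t* = Q -> U *m Q = z *: Q ->
    (forall p (X : 'M_(m, p)), U *m X = z *: X -> Q *m X = X) ->
  Q = (2 / (k%:R * ((1 - z ^+ 2) * (1 - z^-1 ^+ 2)))) *:
      (lift_mx z *m E *m lift_mx z ^t*).
Proof.
move=> zz z2 lE Eadj AE_E Efix Qadj UQ Qfix.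
have z0 : z != 0 by apply: contra_eq_neq zz => ->; rewrite mulr0 eq_sym oner_neq0.
have zV : z^* = z^-1 by apply: (mulIf z0); rewrite zz mulVf.
set c := _ / _; set F := _ *: _.
have c_conj : c^* = c.
  rewrite fmorph_div rmorphM /= rmorphM !rmorphB !rmorphXn /= !conjC_nat.
  by rewrite fmorphV /= zV invrK rmorph1 [(1 - z^-1 ^+ 2) * _]mulrC.
have Fadj : F ^t* = F by rewrite adjZ c_conj !adjM trmxCK Eadj mulmxA.
have QF : Q *m F = F.
  apply: Qfix; rewrite /F -scalemxAr [RHS]scalerA [z * c]mulrC -[RHS]scalerA.
  congr (c *: _).
  by rewrite mulmxA (lift_mx_eigen lE z0 AE_E) scalemxAl.
have FQ : F *m Q = Q.
  rewrite /F -scalemxAl -!mulmxA (lift_mx_adj_project z0 UQ zV) -!scalemxAr.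
  rewrite Efix; last by rewrite (compression_eigen z0 UQ) lE.
  rewrite (lift_mx_project UQ) !scalerA -[RHS]scale1r; congr (_ *: _).
  rewrite /c; field.
  by rewrite k_neq0 z0 /= subr_eq0 z2 subr_eq0 eq_sym z2.
by have := congr1 (fun M => M ^t*) FQ; rewrite /= adjM Fadj Qadj QF.
Qed.

(** The projection N* x of an eigenvector does not vanish, since lifting it gives
back a nonzero multiple of x. *)
Lemma walk_eigenvalue_compression z :
  eigenvalue U z -> z ^+ 2 != 1 -> eigenvalue A (k%:R / 2 * (z + z^-1)).
Proof.
move=> Uz z2; have z0 : z != 0.
  apply: contra_eq_neq (walk_eigenvalue_norm Uz) => ->.
  by rewrite mulr0 eq_sym oner_neq0.
have /eigenvalue_colP [x Ux x0] := Uz.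
apply/eigenvalue_colP; exists (N ^t* *m x); first exact: compression_eigen.
apply: contraNneq x0 => y0; have /eqP := lift_mx_project Ux.
rewrite y0 mulmx0 eq_sym scaler_eq0 !mulf_eq0 invr_eq0 (negPf k_neq0).
by rewrite pnatr_eq0 /= subr_eq0 eq_sym (negPf z2).
Qed.

(** Lifting is injective here because its Gram matrix acts on the eigenvector as
the scalar -(k/2) (z - 1/z)^2. *)
Lemma compression_eigenvalue_walk z :
  z^* * z = 1 -> z ^+ 2 != 1 -> eigenvalue A (k%:R / 2 * (z + z^-1)) ->
  eigenvalue U z.
Proof.
move=> zz z2 /eigenvalue_colP [y Ay y0].
have z0 : z != 0 by apply: contra_eq_neq zz => ->; rewrite mulr0 eq_sym oner_neq0.
have zV : z^* = z^-1 by apply: (mulIf z0); rewrite zz mulVf.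
apply/eigenvalue_colP; exists (lift_mx z *m y); first exact: lift_mx_eigen Ay.
apply: contraNneq y0 => Ly0; have := congr1 (mulmx^~ y) (lift_mx_gram zz).
rewrite /= -mulmxA Ly0 mulmx0 mulmxBl -!scalemxAl mul1mx Ay scalerA -scalerBl.
move/esym/eqP; rewrite scaler_eq0 => /orP[|//].
have -> : k%:R *+ 2 - (z + z^*) * (k%:R / 2 * (z + z^-1))
          = - (k%:R / 2 * z ^- 2 * (z ^+ 2 - 1) ^+ 2).
  by rewrite zV; field; rewrite z0.
rewrite oppr_eq0 !mulf_eq0 !invr_eq0 !expf_eq0 (negPf k_neq0) (negPf z0) /=.
by rewrite pnatr_eq0 subr_eq0 (negPf z2).
Qed.

End ProductOfReflections.

(** * The unit circle and roots of unity *)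

Local Open Scope complex_scope.

Section UnitCircle.
Variable R : realType.

Lemma cis0 : cis (0 : R) = 1.
Proof. by rewrite /cis cos0 sin0. Qed.

Lemma cisD (x y : R) : cis (x + y) = cis x * cis y.
Proof.
apply/eqP; rewrite /cis cosD sinD eq_complex /=.
by apply/andP; split; apply/eqP; ring.
Qed.

Lemma cisX (x : R) n : cis x ^+ n = cis (x * n%:R).
Proof.
elim: n => [|n IHn]; first by rewrite mulr0 cis0.
by rewrite exprS IHn -cisD -[in RHS]add1n natrD mulrDr mulr1.
Qed.

(** Here [^*] is the conjugation that forms conjugate pairs; [conj_cis] is the same
identity for the one in [^t*]. *)
Lemma cis_conj (x : R) : (cis x)^* = cis (- x).
Proof. by rewrite /cis cosN sinN. Qed.

Lemma conj_cis (x : R) : Num.conj (cis x) = cis (- x).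
Proof. by rewrite /cis cosN sinN. Qed.

Lemma cis_conj_mul (x : R) : Num.conj (cis x) * cis x = 1.
Proof. by rewrite conj_cis -cisD addNr cis0. Qed.

Lemma cis_neq0 (x : R) : cis x != 0.
Proof.
by apply: contra_eq_neq (cis_conj_mul x) => ->; rewrite mulr0 eq_sym oner_neq0.
Qed.

Lemma cisV (x : R) : (cis x)^-1 = cis (- x).
Proof. by rewrite -[LHS]mul1r -(cis_conj_mul x) mulfK ?cis_neq0 // conj_cis. Qed.

Lemma cis_surj (z : R[i]) : Num.conj z * z = 1 -> exists x, z = cis x.
Proof.
case: z => c s /eqP; rewrite eq_complex /= => /andP[/eqP cs1 _].
have {}cs1 : c ^+ 2 + s ^+ 2 = 1 by rewrite -cs1; ring.
have c11 : -1 <= c <= 1.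
  rewrite -ler_norml -(@expr_le1 _ 2) // real_normK ?num_real // -cs1.
  by rewrite lerDl sqr_ge0.
have [_ cosE] := acos_def c11; have := sin_acos c11.
rewrite -cs1 addrAC subrr add0r sqrtr_sqr => sinE.
have [s0|s0] := lerP 0 s.
  by exists (acos c); rewrite /cis cosE sinE ger0_norm.
by exists (- acos c); rewrite /cis cosN sinN cosE sinE ltr0_norm // opprK.
Qed.

(** If x <> 0 then 0 < |x / 2| < pi, so 1 - cos x = 2 sin^2 (x / 2) > 0. *)
Lemma cis_eq1 (x : R) : `|x| < 2 * pi -> cis x = 1 -> x = 0.
Proof.
wlog x_ge0 : x / 0 <= x => [gen|].
  have [|x_lt0] := lerP 0 x; first exact: gen.
  move=> x_lt x1; apply/eqP; rewrite -oppr_eq0 (gen (- x)) ?normrN ?oppr_ge0 ?ltW //.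
  by rewrite -conj_cis x1 rmorph1.
rewrite ger0_norm // => x_lt /eqP; rewrite eq_complex /= => /andP[/eqP cosx _].
apply/eqP; rewrite eq_le x_ge0 andbT leNgt; apply/negP => x_gt0.
have : 0 < sin (x / 2) by apply: sin_gt0_pi; apply/andP; split; lra.
have x2 : x = x / 2 *+ 2 by field.
move: cosx; rewrite {1}x2 cos_mulr2n cos2sin2 => sin0 /gt_eqF/eqP[]; apply/eqP.
by rewrite -sqrf_eq0; apply/eqP; lra.
Qed.

Lemma cis_real (x : R) : (cis x \is Num.real) = (sin x == 0).
Proof. exact: complex_real. Qed.

Lemma cis_sqr_neq1 (x : R) : cis x \isn't Num.real -> cis x ^+ 2 != 1.
Proof.
rewrite sqrf_eq1 negb_or => x_nreal.
by apply/andP; split; apply: contraNneq x_nreal => ->; rewrite ?rpredN rpred1.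
Qed.

Definition unity_root k : R[i] := cis (2 * pi / k%:R).

(** A geometric sum whose ratio is a k-th root of unity, equal to 1 only
when i = j. *)
Lemma fourier_orthogonality k i j : (i < k)%N -> (j < k)%N ->
  \sum_(l < k) unity_root k ^+ (i * l) * Num.conj (unity_root k ^+ (j * l)) =
  k%:R *+ (i == j).
Proof.
move=> ik jk; set w := unity_root k; pose z := w ^+ i * Num.conj (w ^+ j).
have k_gt0 : (0 < k)%N by exact: leq_ltn_trans (leq0n i) ik.
have kr : (k%:R : R) != 0 by rewrite pnatr_eq0 -lt0n.
transitivity (\sum_(l < k) z ^+ l).
  by apply: eq_bigr => l _; rewrite exprMn -rmorphXn /= !exprM.
have wk : w ^+ k = 1.
  rewrite cisX divfK // /cis -[2 * pi]add0r mulr_natl.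
  by rewrite cosD2pi sinD2pi cos0 sin0.
have zk : z ^+ k = 1.
  rewrite exprMn -rmorphXn /= -!exprM ![(_ * k)%N]mulnC !exprM wk.
  by rewrite !expr1n rmorph1 mulr1.
have zE : z = cis (2 * pi / k%:R * (i%:R - j%:R)).
  by rewrite /z !cisX conj_cis -cisD mulrBr.
have [ij|nij] := eqVneq i j.
  have -> : z = 1 by rewrite zE ij subrr mulr0 cis0.
  by under eq_bigr do rewrite expr1n; rewrite sumr_const card_ord.
have := subrX1 z k; rewrite zk subrr => /esym/eqP.
rewrite mulf_eq0 subr_eq0 => /orP[|/eqP//].
rewrite zE => /eqP/cis_eq1 x0; case/eqP: nij; apply/eqP.
rewrite -(eqr_nat R) -subr_eq0; have /eqP : 2 * pi / k%:R * (i%:R - j%:R) = 0 :> R.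
  apply: x0; rewrite normrM gtr0_norm; last first.
    by rewrite divr_gt0 ?mulr_gt0 ?pi_gt0 ?ltr0n.
  rewrite mulrAC ltr_pdivrMr ?ltr0n // ltr_pM2l ?mulr_gt0 ?pi_gt0 //.
  have : i%:R < k%:R :> R by rewrite ltr_nat.
  have : j%:R < k%:R :> R by rewrite ltr_nat.
  have : 0 <= i%:R :> R by []. have : 0 <= j%:R :> R by [].
  by rewrite ltr_norml => *; apply/andP; split; lra.
rewrite !mulf_eq0 invr_eq0 (negPf kr) pnatr_eq0 /= orbF.
by rewrite (gt_eqF (pi_gt0 R)).
Qed.

End UnitCircle.

Section Trigonometry.
Variables (R : realType) (k : nat).

Lemma kcos_cis (x : R) :
  (k%:R * cos x)%:C = k%:R / 2 * (cis x + (cis x)^-1) :> R[i].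
Proof.
have -> : cis x + (cis x)^-1 = (2 * cos x)%:C.
  apply/eqP; rewrite cisV /cis cosN sinN eq_complex /=.
  by apply/andP; split; apply/eqP; ring.
rewrite !rmorphM /= !rmorph_nat; by field.
Qed.

(** The scalar of [walk_projection] at z = e^{i x}: (1 - z^2) (1 - z^-2) is
-(z - 1/z)^2 and z - 1/z = 2 i sin x. *)
Lemma ksin_cis (x : R) :
  ((2 * k%:R * sin x ^+ 2)^-1)%:C =
  2 / (k%:R * ((1 - cis x ^+ 2) * (1 - (cis x)^-1 ^+ 2))) :> R[i].
Proof.
have -> : (1 - cis x ^+ 2) * (1 - (cis x)^-1 ^+ 2) = (4 * sin x ^+ 2)%:C.
  transitivity (- (cis x - (cis x)^-1) ^+ 2); first by field; rewrite cis_neq0.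
  apply/eqP; rewrite cisV /cis cosN sinN eq_complex /=.
  by apply/andP; split; apply/eqP; ring.
rewrite fmorphV !rmorphM /= !rmorph_nat !invfM.
by move: (k%:R^-1) (_%:C^-1) => u w; field.
Qed.

Lemma kcos_bounds (x : R) : (0 < k)%N -> cis x \isn't Num.real ->
  - k%:R < (k%:R * cos x)%:C < k%:R.
Proof.
move=> k_gt0; rewrite cis_real => s0.
rewrite -!(rmorph_nat (@real_complex R)) -rmorphN !ltcR.
have kr : 0 < k%:R :> R by rewrite ltr0n.
have : cos x ^+ 2 < 1 by rewrite -(cos2Dsin2 x) ltrDl lt0r sqrf_eq0 s0 sqr_ge0.
rewrite -real_normK ?num_real // expr_lt1 // ltr_norml => /andP[c1 c2].
by apply/andP; split; [rewrite -mulrN1 ltr_pM2l | rewrite gtr_pMr].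
Qed.

Lemma kcos_surj (l : R[i]) : (0 < k)%N -> - k%:R < l < k%:R ->
  exists2 x, l = (k%:R * cos x)%:C & cis x \isn't Num.real.
Proof.
move=> k_gt0; rewrite -!(rmorph_nat (@real_complex R)) -rmorphN; case: l => r s.
rewrite !ltcE /= => /andP[/andP[/eqP-> kr] /andP[_ rk]].
have k0 : 0 < k%:R :> R by rewrite ltr0n.
have rk1 : `|r / k%:R| < 1.
  rewrite normrM normfV (gtr0_norm k0) ltr_pdivrMr // mul1r ltr_norml.
  by rewrite kr rk.
have [_ cosE] : 0 <= acos (r / k%:R) <= pi /\ cos (acos (r / k%:R)) = r / k%:R.
  by apply: acos_def; rewrite -ler_norml ltW.
exists (acos (r / k%:R)); first by rewrite cosE mulrC divfK ?gt_eqF.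
rewrite cis_real; apply: contraTneq rk1 => s0; rewrite -leNgt -cosE.
rewrite -(@expr_ge1 _ 2) // real_normK ?num_real //.
by rewrite cos2sin2 s0 expr0n subr0.
Qed.

End Trigonometry.


(** * Arcs of a graph *)

Local Notation head := Defs.head.
Local Notation arc := Defs.arc.

Section Arcs.
Variables (n : nat) (e : rel 'I_n).

Lemma arc_adjacent (p : 'I_(arcs e)) : e (tail p) (head p).
Proof. exact: valP (enum_val p). Qed.

Lemma arc_eq (p q : 'I_(arcs e)) :
  (p == q) = (tail p == tail q) && (head p == head q).
Proof.
apply/eqP/andP => [->|[/eqP tE /eqP hE]] //; apply: enum_val_inj; apply: val_inj.
by rewrite [LHS]surjective_pairing [RHS]surjective_pairing; congr pair.
Qed.

Lemma arc_exists u w : e u w -> exists2 p : 'I_(arcs e), tail p = u & head p = w.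
Proof.
move=> uw; exists (enum_rank (Sub (u, w) uw : arc e)).
  by rewrite /tail enum_rankK.
by rewrite /head enum_rankK.
Qed.

Lemma sum_arcs (V : nmodType) (F : 'I_n -> 'I_n -> V) :
  \sum_(p < arcs e) F (tail p) (head p) = \sum_u \sum_(w | e u w) F u w.
Proof.
rewrite pair_big_dep /= (big_sub [pred p | e p.1 p.2]).
by rewrite (big_enum_val (fun x : arc e => F (val x).1 (val x).2)).
Qed.

Lemma sum_arcs_from (V : nmodType) (F : 'I_n -> V) u :
  \sum_(p < arcs e | tail p == u) F (head p) = \sum_(w | e u w) F w.
Proof.
rewrite big_mkcond (sum_arcs (fun x w => if x == u then F w else 0)) (bigD1 u) //=.
rewrite eqxx [X in _ + X]big1 ?addr0 // => x /negPf xu.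
by apply: big1 => w _; rewrite xu.
Qed.

Definition reversal (e_sym : symmetric e) (p : 'I_(arcs e)) : 'I_(arcs e) :=
  enum_rank (Sub (head p, tail p) (etrans (e_sym _ _) (arc_adjacent p)) : arc e).

Lemma tail_reversal e_sym p : tail (reversal e_sym p) = head p.
Proof. by rewrite /tail enum_rankK. Qed.

Lemma head_reversal e_sym p : head (reversal e_sym p) = tail p.
Proof. by rewrite /head enum_rankK. Qed.

Lemma reversalK e_sym : involutive (reversal e_sym).
Proof.
move=> p; apply/eqP.
by rewrite arc_eq !(tail_reversal, head_reversal) !eqxx.
Qed.

End Arcs.

(** * The matrices of the walk *)

Section WalkMatrices.
Variables (R : realType) (n k : nat) (e : rel 'I_n) (a : 'I_n) (v : 'I_k -> 'I_n).
Hypotheses (e_simple : simple_graph e) (e_regular : regular e k).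
Hypothesis v_enum : enumerates_neighbors e a v.

Let Rv := arc_reversal R e.
Let N := Nmx R e a v.
Let A := Atilde R e a v.
Let U := transition R k e a.
Let rev := reversal e_simple.1.

(** Taking an arc rules out k = 0, where the coin would divide by zero. *)
Lemma degree_gt0 (p : 'I_(arcs e)) : (0 < k)%N.
Proof.
rewrite -(e_regular (tail p)) card_gt0; apply/set0Pn; exists (head p).
by rewrite inE arc_adjacent.
Qed.

Lemma arc_reversal_mul d (M : 'M_(arcs e, d)) p j : (Rv *m M) p j = M (rev p) j.
Proof.
rewrite mxE (bigD1 (rev p)) //= mxE tail_reversal head_reversal !eqxx mul1r.
rewrite big1 ?addr0 // => q; rewrite arc_eq tail_reversal head_reversal mxE.
by rewrite andbC eq_sym [head p == _]eq_sym => /negPf->; rewrite mul0r.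
Qed.

Lemma arc_reversal_involution : Rv *m Rv = 1%:M.
Proof.
apply/matrixP => p q; rewrite arc_reversal_mul !mxE tail_reversal head_reversal.
by rewrite arc_eq andbC.
Qed.

Lemma arc_reversal_adj : Rv ^t* = Rv.
Proof.
apply/matrixP => p q; rewrite !mxE rmorph_nat.
by rewrite andbC [head q == _]eq_sym [tail q == _]eq_sym.
Qed.

Lemma sum_neighbors (V : nmodType) (F : 'I_n -> V) :
  \sum_(w | e a w) F w = \sum_(j < k) F (v j).
Proof.
have [v_inj vP] := v_enum; rewrite -(big_imset F (in2W v_inj)).
apply: eq_bigl => w; apply/idP/imsetP => [/vP[j <-]|[j _ ->]]; first by exists j.
by apply/vP; exists j.
Qed.

Lemma KrowE j l : Krow R v (v j) l = unity_root R k ^+ (j * l.+1).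
Proof.
rewrite /Krow (big_pred1 j) => [|i]; last by rewrite (inj_eq v_enum.1).
by rewrite mxE cisX mulrAC.
Qed.

Lemma Krow_nonneighbor u l : ~~ e a u -> Krow R v u l = 0.
Proof.
move=> au; apply: big_pred0 => j; apply: contraNF au => /eqP vj.
by apply/v_enum.2; exists j.
Qed.

(** The rows of the full k x k Fourier matrix are orthogonal; its column for the
trivial character, all ones, is not a column of K and accounts for the -1. *)
Lemma Krow_mul_conj i j : 
  \sum_l Krow R v (v i) l * Num.conj (Krow R v (v j) l) = k%:R *+ (i == j) - 1.
Proof.
rewrite -[in RHS](inj_eq val_inj) -(fourier_orthogonality R (ltn_ord i) (ltn_ord j)).
under eq_bigr do rewrite !KrowE; case: (k) i j => [[]//|k'] i j /=.
rewrite big_ord_recl !muln0 !expr0 rmorph1 mulr1 addrAC subrr add0r.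
by apply: eq_bigr => l _; rewrite lift0.
Qed.

Lemma Krow_gram l l' :
  \sum_(j < k) Num.conj (Krow R v (v j) l) * Krow R v (v j) l' = k%:R *+ (l == l').
Proof.
have lt_k (i : 'I_k.-1) : (i.+1 < k)%N by case: (k) i => [|k'] [].
rewrite -[l == l'](inj_eq val_inj) -eqSS eq_sym.
rewrite -(fourier_orthogonality R (lt_k _) (lt_k _)); apply: eq_bigr => j _.
by rewrite !KrowE mulrC !(mulnC j).
Qed.

Lemma Nmx_gram : N ^t* *m N = k%:R *: 1%:M.
Proof.
rewrite /N /Nmx tr_row_mx map_col_mx mul_col_row scalemx1 [RHS]scalar_mx_block.
congr block_mx; apply/matrixP => i j; rewrite !mxE.
- pose F w := Num.conj (Krow R v w i) * Krow R v w j.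
  rewrite -Krow_gram -(sum_neighbors F) -(sum_arcs_from e F) [RHS]big_mkcond /=.
  by apply: eq_bigr => p _; rewrite !mxE; case: ifP => // _; rewrite mulr0.
- apply: big1 => p _; rewrite !mxE; case: ifP => [/eqP->|_].
    by rewrite eq_liftF mulr0.
  by rewrite rmorph0 mul0r.
- apply: big1 => p _; rewrite !mxE; case: ifP => [/eqP->|_].
    by rewrite eq_liftF rmorph0 mul0r.
  by rewrite mulr0.
- transitivity (\sum_(p < arcs e | tail p == lift a i) ((i == j)%:R : R[i])).
    rewrite [RHS]big_mkcond /=; apply: eq_bigr => p _; rewrite !mxE rmorph_nat.
    by case: eqP => [->|_]; rewrite ?mul0r // mul1r (inj_eq lift_inj).
  rewrite (sum_arcs_from e (fun=> (i == j)%:R)) sumr_const.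
  have -> : #|e (lift a i)| = k by rewrite -(e_regular (lift a i)) cardsE.
  by case: eqP => //; rewrite mul0rn.
Qed.

(** R carries the arcs with a given tail to those with that head, so an entry of
N* R N is supported on the arcs joining two given vertices: at most one arc, and
none from [a] to itself. *)
Lemma Nmx_compression : A = N ^t* *m Rv *m N.
Proof.
have [e_sym e_irr] := e_simple.
rewrite -mulmxA /A /N /Nmx /Atilde mul_mx_row tr_row_mx map_col_mx mul_col_row.
congr block_mx; apply/matrixP => i j; rewrite !mxE.
- rewrite big1 // => p _; rewrite arc_reversal_mul !mxE tail_reversal.
  case: eqP => [tp|]; rewrite ?rmorph0 ?mul0r //.
  case: eqP => [hp|]; rewrite ?mulr0 //.
  by have := arc_adjacent p; rewrite tp hp e_irr.
- transitivity (\sum_(p < arcs e | tail p == a)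
                  Num.conj (Krow R v (head p) i) *+ (head p == lift a j)).
    rewrite (sum_arcs_from e (fun w => Num.conj (Krow R v w i) *+ (w == lift a j))).
    rewrite [LHS](_ : _ = Num.conj (Krow R v (lift a j) i) *+ e a (lift a j)).
      rewrite big_mkcond (bigD1 (lift a j)) //= eqxx.
      by rewrite big1 ?addr0 => [|w /negPf->]; case: ifP.
    by case: (boolP (e a _)) => //= /Krow_nonneighbor ->; rewrite rmorph0.
  rewrite big_mkcond /=; apply: eq_bigr => p _.
  rewrite arc_reversal_mul !mxE tail_reversal.
  by case: eqP => _; rewrite ?rmorph0 ?mul0r // mulr_natr.
- transitivity (\sum_(p < arcs e | tail p == lift a i)
                  Krow R v (lift a i) j *+ (head p == a)).
    rewrite (sum_arcs_from e (fun w => Krow R v (lift a i) j *+ (w == a))).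
    rewrite [LHS](_ : _ = Krow R v (lift a i) j *+ e a (lift a i)).
      rewrite big_mkcond (bigD1 a) //= eqxx e_sym.
      by rewrite big1 ?addr0 => [|w /negPf->]; case: ifP.
    by case: (boolP (e a _)) => //= /Krow_nonneighbor ->.
  rewrite big_mkcond /=; apply: eq_bigr => p _.
  rewrite arc_reversal_mul !mxE tail_reversal head_reversal rmorph_nat.
  case: eqP => [->|_]; rewrite ?mul0r // mul1r.
  by case: eqP.
transitivity (\sum_(p < arcs e | tail p == lift a i)
                ((head p == lift a j)%:R : R[i])).
  rewrite (sum_arcs_from e (fun w => (w == lift a j)%:R)) big_mkcond.
  rewrite (bigD1 (lift a j)) //= eqxx.
  by rewrite big1 ?addr0 => [|w /negPf->]; case: ifP.
rewrite big_mkcond /=; apply: eq_bigr => p _.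
rewrite arc_reversal_mul !mxE tail_reversal rmorph_nat.
by case: eqP => _; rewrite ?mul0r // mul1r.
Qed.

(** N N* / k is block diagonal, with blocks J / k at the unmarked vertices and
I - J / k at [a]: the +1-eigenprojection of C O_a. *)
Lemma Nmx_mul_adj : N *m N ^t* = (k%:R / 2) *: (coin R k e *m oracle R e a + 1%:M).
Proof.
apply/matrixP => p q; have k_gt0 := degree_gt0 p.
rewrite /N /Nmx tr_row_mx map_col_mx mul_row_col /oracle mul_mx_diag !mxE.
rewrite [X in _ + X](_ : _ = ((tail p == tail q) && (tail p != a))%:R); last first.
  under eq_bigr do rewrite !mxE rmorph_nat -natrM mulnb.
  case: (unliftP a (tail p)) => [x ->|->].
    rewrite (bigD1 x) //= eqxx big1 ?addr0 => [|y yx].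
      by rewrite [tail q == _]eq_sym [lift a x == a]eq_sym neq_lift andbT.
    by rewrite (inj_eq lift_inj) eq_sym (negPf yx).
  by rewrite big1 ?eqxx ?andbF // => y _; rewrite (negPf (neq_lift a y)).
rewrite [X in X + _](_ : _ = if (tail p == a) && (tail q == a)
    then k%:R *+ (head p == head q) - 1 else 0); last first.
  under eq_bigr do rewrite !mxE.
  case: eqP => [tp|_] /=; last by rewrite big1 // => l _; rewrite mul0r.
  case: eqP => [tq|_] /=; last by rewrite big1 // => l _; rewrite rmorph0 mulr0.
  have [_ vP] := v_enum.
  have /vP[i <-] : e a (head p) by rewrite -tp arc_adjacent.
  have /vP[j <-] : e a (head q) by rewrite -tq arc_adjacent.
  by rewrite Krow_mul_conj (inj_eq v_enum.1).
rewrite arc_eq; have k_neq0 : k%:R != 0 :> R[i] by rewrite pnatr_eq0 -lt0n.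
have [tpq|tpq] := eqVneq (tail p) (tail q); last first.
  rewrite /= mulr0 subr0 mul0r !addr0 mulr0.
  by case: eqP => //= tp; case: eqP => // tq; rewrite tp tq eqxx in tpq.
rewrite -tpq andbb /=; case: (tail p == a); case: (head p == head q) => /=; field.
all: by [].
Qed.

Lemma transitionE :
  U = Rv *m ((2 / k%:R) *: (N *m N ^t*) - 1%:M).
Proof.
rewrite Nmx_mul_adj /U /transition -mulmxA; congr (_ *m _).
apply/matrixP => p q; have k_gt0 := degree_gt0 p; rewrite scalerA.
have -> : 2 / k%:R * (k%:R / 2) = 1 :> R[i].
  by field; rewrite pnatr_eq0 -lt0n.
by rewrite scale1r addrK.
Qed.

Lemma transition_real : map_mx Num.conj U = U.
Proof.
have rv : map_mx Num.conj Rv = Rv.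
  by apply/matrixP => p q; rewrite !mxE rmorph_nat.
rewrite /U /transition !map_mxM rv.
congr (_ *m _ *m _); apply/matrixP => p q; rewrite !mxE.
  by rewrite rmorphB rmorphM fmorph_div /= !rmorph_nat.
by rewrite rmorphMn /=; case: ifP; rewrite ?rmorphN rmorph1.
Qed.

(** U has real entries, so conjugating an eigenvector gives one for the conjugate
eigenvalue. *)
Lemma conj_eigenvalue z : eigenvalue U z -> eigenvalue U (Num.conj z).
Proof.
case/eigenvalue_colP => x Ux x0; apply/eigenvalue_colP.
exists (map_mx Num.conj x); last by rewrite map_mx_eq0.
by rewrite -{1}transition_real -map_mxM Ux map_mxZ.
Qed.

Lemma Nmx_same_tail p q : tail p = tail q -> tail p != a -> row p N = row q N.
Proof.
move=> tpq /negPf tp; apply/rowP => l; rewrite !mxE.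
by case: splitP => j _; rewrite !mxE -tpq ?tp.
Qed.

(** The columns of K are nontrivial characters, orthogonal to the trivial one. *)
Lemma Nmx_marked_sum l : \sum_(p | tail p == a) N p l = 0.
Proof.
under eq_bigr do rewrite mxE; case: splitP => j lj; last first.
  by apply: big1 => p /eqP tp; rewrite !mxE tp (negPf (neq_lift a j)).
transitivity (\sum_(p < arcs e | tail p == a) Krow R v (head p) j).
  by apply: eq_bigr => p tp; rewrite mxE tp.
have j_lt : (j.+1 < k)%N by case: (k) j {lj l} => [|k'] [].
rewrite (sum_arcs_from e (fun w => Krow R v w j)) sum_neighbors.
have := fourier_orthogonality R j_lt (leq_ltn_trans (leq0n _) j_lt).
rewrite mulr0n => sum0; rewrite -[RHS]sum0; apply: eq_bigr => i _.
by rewrite KrowE mul0n expr0 rmorph1 mulr1 mulnC.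
Qed.

(** An entry of w = N y is unchanged by reversing the arc, and by changing the
head when the tail is not [a]. Walking along a path of X \ a shows that w is
constant on the arcs with tail other than [a]; every other arc has its reversal
among these. The constant is 0 since w sums to 0 over the arcs leaving [a]. *)
Lemma reversal_invariant_range_eq0 (y : 'cV[R[i]]_(k.-1 + n.-1)) :
  two_connected e -> Rv *m (N *m y) = N *m y -> N *m y = 0.
Proof.
move=> [_ /(_ [set a]%SET)]; rewrite cards1 => /(_ isT) conn.
set w := N *m y => w_rev.
have [e_sym e_irr] := e_simple.
have wr p : w (rev p) 0 = w p 0 by rewrite -arc_reversal_mul w_rev.
have w_tail p q : tail p = tail q -> tail p != a -> w p 0 = w q 0.
  move=> tpq tp; have := congr1 (fun r => (r *m y) 0 0) (Nmx_same_tail tpq tp).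
  by rewrite /= -!row_mul !mxE.
have w_away p q : tail p != a -> tail q != a -> w p 0 = w q 0.
  move=> tp tq; have /connectP[s] : connect
      (fun u w => [&& e u w, u \notin [set a]%SET & w \notin [set a]%SET])
      (tail p) (tail q) by apply: conn; rewrite inE.
  elim: s p tp => [|x s IHs] p tp /=; first by move=> _ tpq; apply: w_tail.
  rewrite !inE => /andP[/and3P[/arc_exists[b tb hb] _ xa] xs] tqE.
  by rewrite (w_tail p b) // -wr (IHs (rev b)) // tail_reversal hb.
have w_const p q : w p 0 = w q 0.
  have away r : exists2 r', w r' 0 = w r 0 & tail r' != a.
    have [tr|tr] := eqVneq (tail r) a; last by exists r.
    exists (rev r); rewrite ?wr // tail_reversal -tr.
    by apply: contraTneq (arc_adjacent r) => ->; rewrite e_irr.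
  by have [[p' <- ?] [q' <- ?]] := (away p, away q); apply: w_away.
apply/matrixP => p z; rewrite ord1 [RHS]mxE; apply/eqP.
have k_gt0 := degree_gt0 p.
have : \sum_(q | tail q == a) w q 0 = 0.
  under eq_bigr do rewrite mxE; rewrite exchange_big big1 //= => l _.
  by rewrite -mulr_suml Nmx_marked_sum mul0r.
under eq_bigr do rewrite (w_const _ p).
rewrite (sum_arcs_from e (fun=> w p 0)) sumr_const.
have -> : #|e a| = k by rewrite -(e_regular a) cardsE.
by move/eqP; rewrite mulrn_eq0 eqn0Ngt k_gt0.
Qed.

Lemma eigenvector1_antisymmetric (x : 'cV[R[i]]_(arcs e)) :
  two_connected e -> U *m x = 1 *: x -> Rv *m x = - x.
Proof.
move=> conn Ux; have [k0|k_gt0] := posnP k.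
  by apply/matrixP => p; have := degree_gt0 p; rewrite k0.
have wE := walk_eigen_project k_gt0 arc_reversal_involution transitionE Ux.
rewrite scale1r in wE.
have /eqP : N *m (N ^t* *m x) = 0.
  apply: reversal_invariant_range_eq0 => //; rewrite wE -scalemxAr mulmxDr mulmxA.
  by rewrite arc_reversal_involution mul1mx addrC.
rewrite wE scaler_eq0 mulf_eq0 invr_eq0 !pnatr_eq0 eqn0Ngt k_gt0 /=.
by rewrite addr_eq0 => /eqP.
Qed.

Lemma antisymmetric_sum_eq0 (x : 'cV[R[i]]_(arcs e)) :
  Rv *m x = - x -> \sum_p x p 0 = 0.
Proof.
move=> xN; have /eqP : \sum_p x p 0 = - \sum_p x p 0.
  rewrite [LHS](reindex_inj (inv_inj (reversalK e_simple.1))) -sumrN.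
  by apply: eq_bigr => p _; rewrite -arc_reversal_mul xN mxE.
by rewrite -addr_eq0 -mulr2n mulrn_eq0 /= => /eqP.
Qed.

End WalkMatrices.

(** * Eigenprojections and conjugate pairs *)

Lemma eq_by_cols (T : Type) m p (B C : 'M[T]_(m, p)) :
  (forall j, col j B = col j C) -> B = C.
Proof.
by move=> eqBC; apply/trmx_inj/row_matrixP => j; rewrite -!tr_col eqBC.
Qed.

Section EigenProjections.
Variables (R : realType) (m : nat) (M : 'M[R[i]]_m) (z : R[i]).

Lemma eigenproj_fix p (V : 'M_(m, p)) : M *m V = z *: V -> eigenproj M z *m V = V.
Proof.
have [_ _ fixP] := eigenprojP M z; move=> MV.
apply: eq_by_cols => j; rewrite !colE -mulmxA; apply/fixP.
by rewrite mulmxA MV -scalemxAl.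
Qed.

Lemma eigenproj_eigen : M *m eigenproj M z = z *: eigenproj M z.
Proof.
have [idem _ fixP] := eigenprojP M z.
apply: eq_by_cols => j; rewrite !colE -scalemxAl -mulmxA; apply/fixP.
by rewrite mulmxA idem.
Qed.

End EigenProjections.

(** A conjugate pair is a bare set without a distinguished element, hence the choice
of the value that k Re z takes on all of its elements. *)
Definition pair_value (R : realType) (k : nat) (P : set R[i]) : R[i] :=
  xget 0 [set l | forall z, P z -> l = (k%:R * complex.Re z)%:C]%classic.

Lemma pair_valueE (R : realType) (k : nat) (x : R) :
  pair_value k [set cis x; cis (- x)]%classic = (k%:R * cos x)%:C.
Proof.
apply: xget_unique => [z [->|->]|l lP] //=; first by rewrite cosN.
by rewrite (lP (cis x)) //; left.
Qed.

Lemma conjugate_pair_eq (R : realType) (x y : R) : cos x = cos y ->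
  [set cis x; cis (- x)]%classic = [set cis y; cis (- y)]%classic.
Proof.
move=> cxy; have /eqP : sin x ^+ 2 = sin y ^+ 2 by rewrite !sin2cos2 cxy.
rewrite eqf_sqr => /orP[] /eqP sxy; rewrite /cis !cosN !sinN cxy sxy //.
by rewrite opprK setUC.
Qed.

Theorem theorem3p2 (R : realType) (n k : nat) (e : rel 'I_n) (a : 'I_n)
    (v : 'I_k -> 'I_n)
    (e_simple : simple_graph e) (e_regular : regular e k)
    (v_enum : enumerates_neighbors e a v) :
  let U := transition R k e a in
  let Rv := arc_reversal R e in
  let N := Nmx R e a v in
  let A := Atilde R e a v in
  [/\ A ^t* = A,
      (forall z, nonreal_eigenvalue U z ->
         exists2 theta : R, z = cis theta & nonreal_eigenvalue U (cis (- theta))),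
      (exists2 f : set R[i] -> R[i],
         set_bij (conjugate_pairs U)
                 [set l | eigenvalue A l /\ - k%:R < l < k%:R]%classic f &
         forall theta : R, nonreal_eigenvalue U (cis theta) ->
           f [set cis theta; cis (- theta)]%classic = (k%:R * cos theta)%:C),
      (forall theta : R, nonreal_eigenvalue U (cis theta) ->
         eigenproj U (cis theta) =
           ((2 * k%:R * sin theta ^+ 2)^-1)%:C *:
             ((N - cis theta *: (Rv *m N))
              *m eigenproj A (k%:R * cos theta)%:C
              *m (N - cis theta *: (Rv *m N)) ^t*)) &
      (two_connected e ->
         forall (x : 'cV[R[i]]_(arcs e)) (c : R[i]), U *m x = 1 *: x ->
           (c *: const_mx 1 : 'cV_(arcs e)) ^t* *m x = 0)].
Proof.
move=> U Rv N A.
have RvRv := arc_reversal_involution R e_simple.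
have Rv_adj := arc_reversal_adj R e.
have NN := Nmx_gram R e_regular v_enum.
have AE := Nmx_compression R e_simple v_enum.
have UE := transitionE R e_regular v_enum.
have k_gt0 z : eigenvalue U z -> (0 < k)%N.
  case/eigenvalue_colP => x _; apply: contraNltn; rewrite leqn0 => /eqP k0.
  by apply/eqP/matrixP => p; have := degree_gt0 e_regular p; rewrite k0.
have thetaP z : nonreal_eigenvalue U z -> exists x, z = cis x.
  move=> [Uz _]; apply/cis_surj.
  exact: (walk_eigenvalue_norm (k_gt0 z Uz) RvRv Rv_adj NN UE Uz).
have to_A x : nonreal_eigenvalue U (cis x) -> eigenvalue A (k%:R * cos x)%:C.
  move=> [Ux x_nreal]; rewrite kcos_cis.
  apply: (walk_eigenvalue_compression (k_gt0 _ Ux) RvRv Rv_adj NN UE AE) => //.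
  exact: cis_sqr_neq1.
split.
- exact: compression_hermitian Rv_adj AE.
- move=> z Uz; have [x zE] := thetaP z Uz; exists x => //.
  move: Uz; rewrite zE => -[Ux x_nreal]; rewrite -conj_cis; split.
    exact: conj_eigenvalue.
  by rewrite conj_cis cis_real sinN oppr_eq0 -cis_real.
- exists (pair_value k); last by move=> x _; apply: pair_valueE.
  have pairE P : conjugate_pairs U P -> exists2 x, nonreal_eigenvalue U (cis x) &
      P = [set cis x; cis (- x)]%classic.
    case=> z Uz ->; have [x zE] := thetaP z Uz; exists x; first by rewrite -zE.
    by rewrite zE cis_conj.
  split.
  + move=> P /pairE[x Ux ->]; rewrite pair_valueE; split; first exact: to_A.
    by apply: kcos_bounds Ux.2; apply: k_gt0 Ux.1.
  + move=> P Q /set_mem/pairE[x Ux ->] /set_mem/pairE[y _ ->].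
    rewrite !pair_valueE => -[] /mulfI kxy; apply: conjugate_pair_eq; apply: kxy.
    by rewrite pnatr_eq0 -lt0n; apply: k_gt0 Ux.1.
  move=> l [Al l_bound]; have k0 : (0 < k)%N.
    case: (k) l_bound => // /andP[]; rewrite oppr0 => /lt_trans/[apply].
    by rewrite ltxx.
  have [x lE x_nreal] := kcos_surj k0 l_bound.
  exists [set cis x; cis (- x)]%classic; last by rewrite pair_valueE.
  exists (cis x); last by rewrite cis_conj.
  split=> //; apply: (compression_eigenvalue_walk k0 RvRv Rv_adj NN UE AE).
  + exact: cis_conj_mul.
  + exact: cis_sqr_neq1.
  by rewrite -kcos_cis -lE.
- move=> x [Ux x_nreal]; rewrite ksin_cis.
  have [_ Eadj _] := eigenprojP A (k%:R * cos x)%:C.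
  have [_ Qadj _] := eigenprojP U (cis x).
  apply: (walk_projection (k_gt0 _ Ux) RvRv Rv_adj NN UE AE
            (l := (k%:R * cos x)%:C)) => //.
  + exact: cis_conj_mul.
  + exact: cis_sqr_neq1.
  + exact: kcos_cis.
  + exact: eigenproj_eigen.
  + by move=> p Y; apply: eigenproj_fix.
  + exact: eigenproj_eigen.
  by move=> p Y; apply: eigenproj_fix.
move=> conn x c Ux.
have x_anti := eigenvector1_antisymmetric e_simple e_regular v_enum conn Ux.
apply/matrixP => i j; rewrite !ord1 [RHS]mxE mxE.
under eq_bigr do rewrite !mxE mulr1.
by rewrite -mulr_sumr (antisymmetric_sum_eq0 e_simple x_anti) mulr0.
Qed.
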